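(* Fix $(\alpha_0,u_0,T_0)$ with $0<\alpha_0<1$, $u_0\in\mathbb R$, $T_0>0$, and fix $u\ne u_0$. Let $$G(\alpha,u,T)=\left(\frac{p}{p_0}-1\right)\left(\frac{v}{v_0}-1\right)+\frac{(u-u_0)^2}{a^2T_0(1+\alpha_0)}.$$ Then the set $\{(\alpha,T):0<\alpha<1,\ T>0,\ G(\alpha,u,T)=0\}$ is constituted by the graphs of two continuous functions $T_-(\alpha)<T_+(\alpha)$, $\alpha\in(0,1)$, satisfying $T_-(\alpha_0)<T_0<T_+(\alpha_0)$. The function $T_+$ is differentiable and its graph is located in the region $p(\alpha,T)>p_0$. Moreover, $\lim_{\alpha\to1}T_\pm(\alpha)=\infty$, and for $\alpha\to1$ $$1-\alpha\sim\frac{1-\alpha_0}{\alpha_0^2}e^{-\frac{T_{\rm i}}{T_0}}\left(\frac{T}{T_0}\right)^{-\frac32}\ \text{along } T=T_+(\alpha),\qquad 1-\alpha\sim\frac{1-\alpha_0^2}{2\alpha_0^2}e^{-\frac{T_{\rm i}}{T_0}}\left(\frac{T}{T_0}\right)^{-\frac52}\ \text{along } T=T_-(\alpha).$$ Near $\alpha=1$, both curves are located under the thermodynamic part $T=T(\alpha)$ of the Hugoniot locus of $(\alpha_0,T_0)$, i.e. $T_\pm(\alpha)<T(\alpha)$ for all $\alpha<1$ sufficiently close to $1$.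
   Context: Fix positive constants $a^2$, $T_{\rm i}$, $\kappa$. For an ionized gas with degree of ionization $\alpha\in(0,1)$ and temperature $T>0$, put $p=p(\alpha,T)=\frac1\kappa\frac{1-\alpha^2}{\alpha^2}T^{5/2}e^{-T_{\rm i}/T}$, $v=a^2(1+\alpha)T/p$, $e=a^2\left[\frac32(1+\alpha)T+T_{\rm i}\alpha\right]$; $p_0,v_0,e_0$ are the values at $(\alpha_0,T_0)$. The equation $G=0$ is equivalent to $(u-u_0)^2+(p-p_0)(v-v_0)=0$. The thermodynamic part of the Hugoniot locus of $(\alpha_0,T_0)$ is the set of $(\alpha,T)$ with $e-e_0+\frac12(p+p_0)(v-v_0)=0$; it is the graph of a strictly increasing function $T=T(\alpha)$, $\alpha\in(0,1)$. *)

(* Defs.v *)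
From Stdlib Require Import Reals.
From Coquelicot Require Import Coquelicot.
Open Scope R_scope.

(** Thermodynamics of an ionized gas with degree of ionization [alpha] and
    temperature [T].  Everything below is only meaningful for [0 < alpha < 1]
    and [0 < T]; elsewhere the values are junk ([Rpower x y] is
    [exp (y * ln x)], and division is total). *)

Definition pressure (Ti kappa alpha T : R) : R :=
  / kappa * ((1 - alpha ^ 2) / alpha ^ 2) * Rpower T (5 / 2) * exp (- (Ti / T)).

Definition spec_volume (a Ti kappa alpha T : R) : R :=
  a ^ 2 * (1 + alpha) * T / pressure Ti kappa alpha T.

Definition energy (a Ti alpha T : R) : R :=
  a ^ 2 * (3 / 2 * (1 + alpha) * T + Ti * alpha).

Definition G (a Ti kappa alpha0 u0 T0 alpha u T : R) : R :=
  (pressure Ti kappa alpha T / pressure Ti kappa alpha0 T0 - 1) *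
  (spec_volume a Ti kappa alpha T / spec_volume a Ti kappa alpha0 T0 - 1) +
  (u - u0) ^ 2 / (a ^ 2 * T0 * (1 + alpha0)).

Definition thermo_hugoniot (a Ti kappa alpha0 T0 alpha T : R) : Prop :=
  energy a Ti alpha T - energy a Ti alpha0 T0 +
  / 2 * (pressure Ti kappa alpha T + pressure Ti kappa alpha0 T0) *
        (spec_volume a Ti kappa alpha T - spec_volume a Ti kappa alpha0 T0) = 0.

(** The part of the planar set [S] lying in [(0,1) x (0,+oo)] is the graph of
    the positive function [f] on [(0,1)]. *)
Definition is_graph (S : R -> R -> Prop) (f : R -> R) : Prop :=
  (forall alpha, 0 < alpha < 1 -> 0 < f alpha) /\
  (forall alpha T, 0 < alpha < 1 -> 0 < T -> (S alpha T <-> T = f alpha)).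

(** Same, for the union of the graphs of two positive functions. *)
Definition is_union_of_graphs (S : R -> R -> Prop) (f g : R -> R) : Prop :=
  (forall alpha, 0 < alpha < 1 -> 0 < f alpha /\ 0 < g alpha) /\
  (forall alpha T, 0 < alpha < 1 -> 0 < T ->
     (S alpha T <-> T = f alpha \/ T = g alpha)).

(* Main.v *)
Require Import Defs.
From Stdlib Require Import Reals Ranalysis5 Lra IndefiniteDescription.
From Coquelicot Require Import Coquelicot.
Open Scope R_scope.

(** Write [q = p/p0] and [nu = v/v0].  Along the set [G = 0] one has
    [(q - 1) (1 - nu) = m], where [m = (u - u0)^2 / (p0 v0) > 0] and
    [p0 v0 = a^2 (1 + alpha0) T0].

    At fixed [alpha], [q] increases strictly from 0 to infinity with [T], while
    [nu] decreases strictly from infinity to 0.  Both factors must have the same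
    sign.  If both are positive, each increases with [T] and the product takes
    the value [m] exactly once: this is [T_+], where [q > 1].  If both are
    negative, the product of their absolute values decreases from infinity to
    0: this is [T_-], where [q < 1].  Comparing [q] with 1, its value at
    [(alpha0, T0)], gives [T_- < T_+], the position of [T0] and the region
    [p > p0].  The functions [excess_plus] and [excess_minus] vanish on the two
    curves and change sign across them, from which continuity follows
    ([crossing_continuous]); the derivative of [(q - 1) (1 - nu)] in [T] is
    positive on the upper curve, hence [T_+] is differentiable
    ([is_derive_implicit]).

    As [alpha] tends to 1 with [T] fixed, [q] tends to 0 and [nu] to infinity,
    so both curves eventually lie above any given temperature.  The product
    [q nu] is [(1 + alpha) T / ((1 + alpha0) T0)], hence tends to infinity along
    both curves, and the relation [(q - 1) (1 - nu) = m] then forces [nu] to 1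
    along [T_+] and [q] to 1 along [T_-] ([smaller_ratio_gt]).  Solving
    the explicit formulas of [nu] and [q] for [1 - alpha] gives the two
    equivalents.

    The Hugoniot function, divided by [p0 v0 / 2], is
    [4 (q nu - 1) + 2 Ti (alpha - alpha0) / ((1 + alpha0) T0) - q + nu]
    ([hugoniot_normalized]).  For [alpha] close to 1 it is positive for every
    [T <= T_+(alpha)] ([hugoniot_pos_below_Tp]), so its zero lies above [T_+]. *)

(** * Functions of one variable with a single sign change *)

Lemma continuous_locally_lt (h : R -> R) (x c : R) :
  continuous h x -> h x < c -> locally x (fun y => h y < c).
Proof. intros Hh Hx. apply (Hh (fun z => z < c)). now apply (open_lt c). Qed.

Lemma continuous_locally_gt (h : R -> R) (x c : R) :
  continuous h x -> c < h x -> locally x (fun y => c < h y).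
Proof. intros Hh Hx. apply (Hh (fun z => c < z)). now apply (open_gt c). Qed.


Definition crosses_at (h : R -> R) (t : R) : Prop :=
  h t = 0 /\ forall x, 0 < x -> (x < t -> h x < 0) /\ (t < x -> 0 < h x).

Lemma crosses_at_neg h t x : crosses_at h t -> 0 < x -> h x < 0 -> x < t.
Proof.
  intros [H0 H] Hx Hn. destruct (Rtotal_order x t) as [|[->|Hlt]]; [easy|lra|].
  apply (H x Hx) in Hlt. lra.
Qed.

Lemma crosses_at_pos h t x : crosses_at h t -> 0 < x -> 0 < h x -> t < x.
Proof.
  intros [H0 H] Hx Hn. destruct (Rtotal_order x t) as [Hlt|[->|]]; [|lra|easy].
  apply (H x Hx) in Hlt. lra.
Qed.

Lemma crosses_at_unique h t x : crosses_at h t -> 0 < x -> h x = 0 -> x = t.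
Proof.
  intros [H0 H] Hx Hn. destruct (Rtotal_order x t) as [Hlt|[|Hlt]]; [|easy|];
    apply (H x Hx) in Hlt; lra.
Qed.

Lemma crosses_at_exists h a b :
  (forall x, 0 < x -> continuous h x) ->
  0 < a -> a < b -> h a < 0 -> 0 < h b ->
  (forall x y, 0 < x < y -> h x = 0 -> 0 < h y) ->
  (forall x y, 0 < x < y -> h y = 0 -> h x < 0) ->
  exists t, 0 < t /\ crosses_at h t.
Proof.
  intros Hc Ha Hab Hna Hpb Hup Hdown.
  destruct (IVT_interv h a b) as [t [[Hat Htb] Ht]]; try easy.
  - intros y Hy. apply continuity_pt_filterlim, Hc. lra.
  - exists t. split; [lra|]. split; [easy|]. intros x Hx. split; intros Hlt.
    + apply (Hdown x t); easy.
    + apply (Hup t x); [lra|easy].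
Qed.

(** The signs of [F] at the heights [f x - d] and [f x + d] are open conditions
    on the first argument, and they trap the crossing point between these two
    heights. *)
Lemma crossing_continuous (F : R -> R -> R) (f : R -> R) (x : R) :
  (forall T, 0 < T -> continuous (fun y => F y T) x) ->
  locally x (fun y => 0 < f y /\ crosses_at (F y) (f y)) ->
  continuous f x.
Proof.
  intros Hc Hf.
  destruct (locally_singleton _ _ Hf) as [Hpos [_ Hx]].
  apply filterlim_locally. intros eps.
  set (d := Rmin (eps / 2) (f x / 2)).
  assert (Hd : 0 < d /\ d < eps /\ d < f x).
  { assert (He := cond_pos eps). unfold d.
    assert (H1 := Rmin_l (eps / 2) (f x / 2)).
    assert (H2 := Rmin_r (eps / 2) (f x / 2)).
    split; [apply Rmin_glb_lt|]; lra. }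
  assert (Hlo : locally x (fun y => F y (f x - d) < 0)).
  { apply (continuous_locally_lt (fun y => F y (f x - d))); [apply Hc; lra|].
    apply (Hx (f x - d)); lra. }
  assert (Hhi : locally x (fun y => 0 < F y (f x + d))).
  { apply (continuous_locally_gt (fun y => F y (f x + d))); [apply Hc; lra|].
    apply (Hx (f x + d)); lra. }
  generalize (filter_and _ _ Hf (filter_and _ _ Hlo Hhi)).
  apply filter_imp. intros y [[Hy Hcr] [H1 H2]].
  apply crosses_at_neg with (1 := Hcr) in H1; [|lra].
  apply crosses_at_pos with (1 := Hcr) in H2; [|lra].
  change (Rabs (f y - f x) < eps). apply Rabs_def1; lra.
Qed.

(** * Products of positive parts *)

Definition pos_prod (a b : R) : R := Rmax a 0 * Rmax b 0.

Lemma pos_prod_pos a b : 0 < a -> 0 < b -> pos_prod a b = a * b.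
Proof. intros Ha Hb. unfold pos_prod. rewrite !Rmax_left; lra. Qed.

Lemma pos_prod_npos_l a b : a <= 0 -> pos_prod a b = 0.
Proof. intros Ha. unfold pos_prod. rewrite (Rmax_right a); lra. Qed.

Lemma pos_prod_npos_r a b : b <= 0 -> pos_prod a b = 0.
Proof. intros Ha. unfold pos_prod. rewrite (Rmax_right b); lra. Qed.

Lemma pos_prod_level m a b :
  0 < m -> pos_prod a b = m -> 0 < a /\ 0 < b /\ a * b = m.
Proof.
  intros Hm H.
  destruct (Rle_lt_dec a 0) as [Ha|Ha].
  { rewrite pos_prod_npos_l in H; lra. }
  destruct (Rle_lt_dec b 0) as [Hb|Hb].
  { rewrite pos_prod_npos_r in H; lra. }
  rewrite pos_prod_pos in H; auto.
Qed.

Lemma pos_prod_level_gt m a b a' b' :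
  0 < m -> pos_prod a b = m -> a < a' -> b < b' -> m < pos_prod a' b'.
Proof.
  intros Hm H Ha Hb. destruct (pos_prod_level m a b Hm H) as [H1 [H2 <-]].
  rewrite pos_prod_pos; try lra. apply Rmult_gt_0_lt_compat; lra.
Qed.

Lemma pos_prod_level_lt m a b a' b' :
  0 < m -> pos_prod a b = m -> a' < a -> b' < b -> pos_prod a' b' < m.
Proof.
  intros Hm H Ha Hb. destruct (pos_prod_level m a b Hm H) as [H1 [H2 H3]].
  destruct (Rle_lt_dec a' 0) as [Ha'|Ha'].
  { rewrite pos_prod_npos_l; lra. }
  destruct (Rle_lt_dec b' 0) as [Hb'|Hb'].
  { rewrite pos_prod_npos_r; lra. }
  rewrite pos_prod_pos; try lra. rewrite <- H3.
  apply Rmult_gt_0_lt_compat; lra.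
Qed.

Lemma continuous_pos_prod (f g : R -> R) x :
  continuous f x -> continuous g x ->
  continuous (fun y => pos_prod (f y) (g y)) x.
Proof.
  assert (Hpos : forall h : R -> R, continuous h x ->
                   continuous (fun y => Rmax (h y) 0) x).
  { intros h Hh.
    apply continuous_ext with (f := fun y => scal (/ 2) (plus (h y) (Rabs (h y)))).
    { intros y. unfold scal, plus; simpl; unfold mult; simpl.
      destruct (Rle_lt_dec (h y) 0).
      - rewrite Rmax_right, Rabs_left1; lra.
      - rewrite Rmax_left, Rabs_pos_eq; lra. }
    apply (continuous_scal_r (/ 2) (fun y => plus (h y) (Rabs (h y)))).
    apply (continuous_plus h (fun y => Rabs (h y))); [easy|].
    now apply (continuous_Rabs_comp h). }
  intros Hf Hg. apply (continuous_mult (fun y => Rmax (f y) 0) (fun y => Rmax (g y) 0));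
    now apply Hpos.
Qed.

(** * Implicit differentiation *)

(** The relation [F y (f y) = F x (f x)] says that the linearization of [F] along
    the graph of [f] is negligible compared with the increments; division by [ly] gives the
    linearization of [f], once the increment of [f] itself is controlled. *)
Lemma is_derive_implicit (F : R -> R -> R) (f : R -> R) (x lx ly : R) :
  differentiable_pt_lim F x (f x) lx ly -> ly <> 0 -> continuous f x ->
  locally x (fun y => F y (f y) = F x (f x)) ->
  is_derive f x (- lx / ly).
Proof.
  intros HF Hly Hf Heq.
  set (l := - lx / ly).
  assert (Hl : lx = - (ly * l)) by (unfold l; field; easy).
  assert (Hpos : 0 < Rabs ly) by now apply Rabs_pos_lt.
  split; [apply is_linear_scal_l|].
  intros z Hz. rewrite <- (is_filter_lim_locally_unique _ _ Hz). intros eps.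
  set (e := Rmin (/ 2) (eps / (2 * (1 + Rabs l)))).
  assert (Hl1 : 0 < 1 + Rabs l) by (assert (H := Rabs_pos l); lra).
  assert (He : 0 < e).
  { assert (H := cond_pos eps). apply Rmin_glb_lt; [lra|].
    apply Rdiv_lt_0_compat; lra. }
  assert (He1 : e <= / 2) by apply Rmin_l.
  assert (He2 : 2 * e * (1 + Rabs l) <= eps).
  { assert (H : e <= eps / (2 * (1 + Rabs l))) by apply Rmin_r.
    apply Rmult_le_compat_r with (r := 2 * (1 + Rabs l)) in H; [|lra].
    replace (eps / (2 * (1 + Rabs l)) * (2 * (1 + Rabs l))) with (pos eps) in H
      by (field; lra). lra. }
  destruct (HF (mkposreal _ (Rmult_lt_0_compat _ _ He Hpos))) as [d Hd].
  assert (Hball : locally x (fun y => Rabs (y - x) < d)).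
  { exists d. intros y Hy. exact Hy. }
  assert (Hfball : locally x (fun y => Rabs (f y - f x) < d)).
  { apply (Hf (fun z => Rabs (z - f x) < d)). exists d. intros y Hy. exact Hy. }
  generalize (filter_and _ _ Heq (filter_and _ _ Hball Hfball)).
  apply filter_imp. intros y [Hy [Hy1 Hy2]].
  specialize (Hd y (f y) Hy1 Hy2). simpl in Hd.
  change (Rabs (f y - f x - (y - x) * l) <= eps * Rabs (y - x)).
  rewrite Hy in Hd.
  set (r := f y - f x - (y - x) * l).
  replace (F x (f x) - F x (f x) - (lx * (y - x) + ly * (f y - f x)))
    with (- (ly * r)) in Hd by (unfold r; rewrite Hl; ring).
  rewrite Rabs_Ropp, Rabs_mult in Hd.
  assert (Hr : Rabs r <= e * Rmax (Rabs (y - x)) (Rabs (f y - f x))).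
  { apply Rmult_le_reg_l with (Rabs ly); [easy|]. lra. }
  (* The increment of [f] is itself bounded by [|l| |y - x| + |r|], and since
     [e <= 1/2] the contribution of [r] is absorbed into the left-hand side. *)
  assert (Hmax : Rmax (Rabs (y - x)) (Rabs (f y - f x))
                 <= (1 + Rabs l) * Rabs (y - x) + Rabs r).
  { assert (H0 := Rabs_pos r). assert (H1 := Rabs_pos (y - x)).
    assert (H2 := Rabs_pos l). assert (H3 := Rabs_triang r ((y - x) * l)).
    replace (r + (y - x) * l) with (f y - f x) in H3 by (unfold r; ring).
    rewrite Rabs_mult in H3. apply Rmax_lub; nra. }
  assert (Hr' : Rabs r <= 2 * e * (1 + Rabs l) * Rabs (y - x)).
  { assert (H0 := Rabs_pos r). assert (H1 := Rabs_pos (y - x)). nra. }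
  assert (H1 := Rabs_pos (y - x)). nra.
Qed.

Lemma differentiable_pt_lim_snd (g : R -> R) (x y l : R) :
  is_derive g y l -> differentiable_pt_lim (fun _ v => g v) x y 0 l.
Proof.
  intros Hg. apply is_derive_Reals in Hg.
  apply differentiable_pt_lim_proj1_0 with (y := x) in Hg.
  intros eps. destruct (Hg eps) as [d Hd]. exists d. intros u v Hu Hv.
  specialize (Hd v u Hv Hu). rewrite Rmax_comm.
  now replace (0 * (u - x) + l * (v - y)) with (l * (v - y) + 0 * (u - x)) by ring.
Qed.

(** Products of affine functions are of this kind: their linearization misses
    only the product of the two increments, up to sign. *)
Lemma differentiable_pt_lim_bilinear (f : R -> R -> R) (x y lx ly : R) :
  (forall u v, Rabs (f u v - f x y - (lx * (u - x) + ly * (v - y)))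
               = Rabs (u - x) * Rabs (v - y)) ->
  differentiable_pt_lim f x y lx ly.
Proof.
  intros H eps. exists eps. intros u v Hu Hv. rewrite H.
  assert (H1 := Rmax_r (Rabs (u - x)) (Rabs (v - y))).
  assert (H2 := Rabs_pos (u - x)). assert (H3 := Rabs_pos (v - y)). nra.
Qed.

Lemma differentiable_pt_lim_sep (A g : R -> R) (x y dA dg : R) :
  is_derive A x dA -> is_derive g y dg ->
  differentiable_pt_lim (fun u v => A u * g v) x y (g y * dA) (A x * dg).
Proof.
  intros HA Hg.
  replace (g y * dA) with (g y * dA + A x * 0) by ring.
  replace (A x * dg) with (g y * 0 + A x * dg) by ring.
  apply (differentiable_pt_lim_comp Rmult (fun u _ => A u) (fun _ v => g v)).
  - apply differentiable_pt_lim_bilinear. intros u v. rewrite <- Rabs_mult.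
    f_equal. ring.
  - apply differentiable_pt_lim_proj1_0. now apply is_derive_Reals.
  - now apply differentiable_pt_lim_snd.
Qed.

(** * Limits at the right end point of (0,1) *)

Lemma at_left_unit : at_left 1 (fun alpha => 0 < alpha < 1).
Proof.
  assert (H : locally 1 (fun y => 0 < y)) by (apply (open_gt 0); lra).
  unfold at_left, within. revert H. apply filter_imp. intros; split; easy.
Qed.

Lemma at_left_lt_of_continuous (h : R -> R) (c : R) :
  continuous h 1 -> h 1 < c -> at_left 1 (fun alpha => h alpha < c).
Proof.
  intros Hc Hlt. unfold at_left, within.
  generalize (continuous_locally_lt h 1 c Hc Hlt). now apply filter_imp.
Qed.

Lemma filterlim_p_infty_intro {U} (F : (U -> Prop) -> Prop) {FF : Filter F}
    (f : U -> R) :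
  (forall M, 0 < M -> F (fun x => M < f x)) ->
  filterlim f F (Rbar_locally p_infty).
Proof.
  intros H P [M HM]. unfold filtermap.
  assert (H1 := Rmax_l 1 M). assert (H2 := Rmax_r 1 M).
  generalize (H (Rmax 1 M) ltac:(lra)). apply filter_imp. intros x Hx.
  apply HM. lra.
Qed.

Lemma filterlim_1_from_below {U} (F : (U -> Prop) -> Prop) {FF : Filter F}
    (f : U -> R) :
  (forall eps, 0 < eps -> F (fun x => 1 - eps < f x < 1)) ->
  filterlim f F (locally 1).
Proof.
  intros H. apply filterlim_locally. intros eps.
  generalize (H eps (cond_pos eps)). apply filter_imp. intros x Hx.
  change (Rabs (f x - 1) < eps). apply Rabs_def1; lra.
Qed.

Lemma filterlim_Rmult {U} (F : (U -> Prop) -> Prop) {FF : Filter F}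
    (f g : U -> R) (lf lg : R) :
  filterlim f F (locally lf) -> filterlim g F (locally lg) ->
  filterlim (fun x => f x * g x) F (locally (lf * lg)).
Proof.
  intros Hf Hg. eapply filterlim_comp_2; [exact Hf|exact Hg|].
  exact (filterlim_mult lf lg).
Qed.

Lemma is_equiv_of_factor {U} (F : (U -> Prop) -> Prop) {FF : Filter F}
    (f g h : U -> R) :
  F (fun x => f x = g x * h x) -> filterlim h F (locally 1) -> is_equiv F f g.
Proof.
  intros Heq Hh eps.
  apply (filterlim_locally h 1) with (eps := eps) in Hh.
  generalize (filter_and _ _ Heq Hh). apply filter_imp. intros x [-> Hx].
  change (Rabs (h x - 1) < eps) in Hx.
  change (Rabs (g x - g x * h x) <= eps * Rabs (g x)).
  replace (g x - g x * h x) with (- (g x * (h x - 1))) by ring.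
  rewrite Rabs_Ropp, Rabs_mult. assert (H := Rabs_pos (g x)). nra.
Qed.

Lemma filterlim_Rmult_1 {U} (F : (U -> Prop) -> Prop) {FF : Filter F}
    (f g : U -> R) :
  filterlim f F (locally 1) -> filterlim g F (locally 1) ->
  filterlim (fun x => f x * g x) F (locally 1).
Proof.
  intros Hf Hg. assert (H := filterlim_Rmult F f g 1 1 Hf Hg).
  now rewrite Rmult_1_r in H.
Qed.

Lemma filterlim_at_left_continuous (h : R -> R) (l : R) :
  continuous h 1 -> h 1 = l -> filterlim h (at_left 1) (locally l).
Proof. intros Hh <-. revert Hh. apply filterlim_filter_le_1, filter_le_within. Qed.

(** * Ratios of pressure and volume *)

Section IonizedGas.

Variables Ti kp kv : R.
Hypotheses (HTi : 0 < Ti) (Hkp : 0 < kp) (Hkv : 0 < kv).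

(** [prat] and [vrat] are [p/p0] and [v/v0] with the reference values gathered
    in the constants [kp] and [kv].  Powers of [T] are kept inside the
    exponential, so that monotonicity in [T] is read off one exponent. *)
Definition prat (alpha T : R) : R :=
  kp * ((1 - alpha ^ 2) / alpha ^ 2) * exp (5 / 2 * ln T - Ti / T).

Definition vrat (alpha T : R) : R :=
  kv * (alpha ^ 2 / (1 - alpha)) * exp (Ti / T - 3 / 2 * ln T).

Lemma prat_coef_pos alpha : 0 < alpha < 1 -> 0 < kp * ((1 - alpha ^ 2) / alpha ^ 2).
Proof.
  intros Ha. apply Rmult_lt_0_compat; [easy|]. apply Rdiv_lt_0_compat; nra.
Qed.

Lemma vrat_coef_pos alpha : 0 < alpha < 1 -> 0 < kv * (alpha ^ 2 / (1 - alpha)).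
Proof.
  intros Ha. apply Rmult_lt_0_compat; [easy|]. apply Rdiv_lt_0_compat; nra.
Qed.

Lemma prat_pos alpha T : 0 < alpha < 1 -> 0 < prat alpha T.
Proof. intros Ha. apply Rmult_lt_0_compat; [now apply prat_coef_pos|apply exp_pos]. Qed.

Lemma prat_mult_vrat alpha T :
  0 < alpha < 1 -> 0 < T -> prat alpha T * vrat alpha T = kp * kv * (1 + alpha) * T.
Proof.
  intros Ha HT. unfold prat, vrat.
  transitivity (kp * kv * (1 + alpha) *
    (exp (5 / 2 * ln T - Ti / T) * exp (Ti / T - 3 / 2 * ln T))).
  { field. lra. }
  rewrite <- exp_plus.
  replace (5 / 2 * ln T - Ti / T + (Ti / T - 3 / 2 * ln T)) with (ln T) by (field; lra).
  now rewrite exp_ln.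
Qed.

Lemma Ti_div_decr x y : 0 < x < y -> Ti / y < Ti / x.
Proof.
  intros H. apply Rmult_lt_compat_l; [easy|]. apply Rinv_lt_contravar; nra.
Qed.

Lemma prat_incr alpha x y : 0 < alpha < 1 -> 0 < x < y -> prat alpha x < prat alpha y.
Proof.
  intros Ha Hxy. apply Rmult_lt_compat_l; [now apply prat_coef_pos|].
  apply exp_increasing. assert (H1 := Ti_div_decr x y Hxy).
  assert (H2 : ln x < ln y) by (apply ln_increasing; lra). lra.
Qed.

Lemma vrat_decr alpha x y : 0 < alpha < 1 -> 0 < x < y -> vrat alpha y < vrat alpha x.
Proof.
  intros Ha Hxy. apply Rmult_lt_compat_l; [now apply vrat_coef_pos|].
  apply exp_increasing. assert (H1 := Ti_div_decr x y Hxy).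
  assert (H2 : ln x < ln y) by (apply ln_increasing; lra). lra.
Qed.

Lemma prat_lt_inv alpha x y :
  0 < alpha < 1 -> 0 < x -> 0 < y -> prat alpha x < prat alpha y -> x < y.
Proof.
  intros Ha Hx Hy H. destruct (Rtotal_order x y) as [|[->|Hlt]]; [easy|lra|].
  assert (H1 := prat_incr alpha y x Ha (conj Hy Hlt)). lra.
Qed.

Lemma continuous_prat_T alpha T : 0 < T -> continuous (prat alpha) T.
Proof.
  intros HT. apply (@ex_derive_continuous R_AbsRing R_NormedModule).
  unfold prat. auto_derive. lra.
Qed.

Lemma continuous_vrat_T alpha T : 0 < T -> continuous (vrat alpha) T.
Proof.
  intros HT. apply (@ex_derive_continuous R_AbsRing R_NormedModule).
  unfold vrat. auto_derive. lra.
Qed.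

Lemma ex_derive_prat_coef alpha :
  0 < alpha < 1 -> ex_derive (fun x => kp * ((1 - x ^ 2) / x ^ 2)) alpha.
Proof. intros Ha. auto_derive. nra. Qed.

Lemma ex_derive_vrat_coef alpha :
  0 < alpha < 1 -> ex_derive (fun x => kv * (x ^ 2 / (1 - x))) alpha.
Proof. intros Ha. auto_derive. lra. Qed.

Lemma continuous_prat_alpha alpha T :
  0 < alpha < 1 -> continuous (fun x => prat x T) alpha.
Proof.
  intros Ha. apply (continuous_mult (fun x => kp * ((1 - x ^ 2) / x ^ 2))).
  - now apply (@ex_derive_continuous R_AbsRing R_NormedModule), ex_derive_prat_coef.
  - apply continuous_const.
Qed.

Lemma continuous_vrat_alpha alpha T :
  0 < alpha < 1 -> continuous (fun x => vrat x T) alpha.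
Proof.
  intros Ha. apply (continuous_mult (fun x => kv * (x ^ 2 / (1 - x)))).
  - now apply (@ex_derive_continuous R_AbsRing R_NormedModule), ex_derive_vrat_coef.
  - apply continuous_const.
Qed.

Lemma is_derive_prat_exp T : 0 < T ->
  exists d, 0 < d /\ is_derive (fun y => exp (5 / 2 * ln y - Ti / y)) T d.
Proof.
  intros HT. exists ((5 / 2 / T + Ti / T ^ 2) * exp (5 / 2 * ln T - Ti / T)).
  split.
  - apply Rmult_lt_0_compat; [|apply exp_pos].
    apply Rplus_lt_0_compat; apply Rdiv_lt_0_compat; nra.
  - auto_derive; [lra|].
    change (5 / 2 * ln T + - (Ti * / T)) with (5 / 2 * ln T - Ti / T).
    field. lra.
Qed.

Lemma is_derive_vrat_exp T : 0 < T ->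
  exists d, d < 0 /\ is_derive (fun y => exp (Ti / y - 3 / 2 * ln y)) T d.
Proof.
  intros HT. exists (- ((Ti / T ^ 2 + 3 / 2 / T) * exp (Ti / T - 3 / 2 * ln T))).
  split.
  - apply Ropp_lt_gt_0_contravar. apply Rmult_lt_0_compat; [|apply exp_pos].
    apply Rplus_lt_0_compat; apply Rdiv_lt_0_compat; nra.
  - auto_derive; [lra|].
    change (Ti * / T + - (3 / 2 * ln T)) with (Ti / T - 3 / 2 * ln T).
    field. lra.
Qed.

Lemma Ti_div_le T : 1 < T -> Ti / T <= Ti.
Proof. intros HT. assert (H := Ti_div_decr 1 T ltac:(lra)). lra. Qed.

(** Crude linear bounds on the temperature factors; they give the limits of
    both ratios as [T] tends to 0 and to infinity. *)
Lemma prat_exp_lt T : 0 < T < 1 -> exp (5 / 2 * ln T - Ti / T) < T.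
Proof.
  intros HT. rewrite <- (exp_ln T) at 3 by easy. apply exp_increasing.
  assert (H1 : ln T < 0) by (rewrite <- ln_1; apply ln_increasing; lra).
  assert (H2 : 0 < Ti / T) by now apply Rdiv_lt_0_compat. lra.
Qed.

Lemma vrat_exp_gt T : 0 < T < 1 -> / T < exp (Ti / T - 3 / 2 * ln T).
Proof.
  intros HT. rewrite <- (exp_ln T) at 1 by easy. rewrite <- exp_Ropp.
  apply exp_increasing.
  assert (H1 : ln T < 0) by (rewrite <- ln_1; apply ln_increasing; lra).
  assert (H2 : 0 < Ti / T) by now apply Rdiv_lt_0_compat. lra.
Qed.

Lemma prat_exp_gt T : 1 < T -> T * exp (- Ti) < exp (5 / 2 * ln T - Ti / T).
Proof.
  intros HT. rewrite <- (exp_ln T) at 1 by lra. rewrite <- exp_plus.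
  apply exp_increasing.
  assert (H1 : 0 < ln T) by (rewrite <- ln_1; apply ln_increasing; lra).
  assert (H2 := Ti_div_le T HT). lra.
Qed.

Lemma vrat_exp_lt T : 1 < T -> exp (Ti / T - 3 / 2 * ln T) < / T * exp Ti.
Proof.
  intros HT. rewrite <- (exp_ln T) at 3 by lra. rewrite <- exp_Ropp, <- exp_plus.
  apply exp_increasing.
  assert (H1 : 0 < ln T) by (rewrite <- ln_1; apply ln_increasing; lra).
  assert (H2 := Ti_div_le T HT). lra.
Qed.

Lemma prat_small_T alpha eps : 0 < alpha < 1 -> 0 < eps ->
  exists d, 0 < d /\ forall T, 0 < T < d -> prat alpha T < eps.
Proof.
  intros Ha He. unfold prat. assert (Hk := prat_coef_pos alpha Ha).
  set (k := kp * ((1 - alpha ^ 2) / alpha ^ 2)) in *. clearbody k.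
  exists (Rmin 1 (eps / k)). split.
  { apply Rmin_glb_lt; [lra|]. now apply Rdiv_lt_0_compat. }
  intros T [HT Hlt].
  assert (H1 := Rmin_l 1 (eps / k)). assert (H2 := Rmin_r 1 (eps / k)).
  apply Rlt_trans with (k * T).
  - apply Rmult_lt_compat_l; [easy|]. apply prat_exp_lt; lra.
  - replace eps with (k * (eps / k)) by (field; lra).
    apply Rmult_lt_compat_l; lra.
Qed.

Lemma vrat_small_T alpha M : 0 < alpha < 1 -> 0 < M ->
  exists d, 0 < d /\ forall T, 0 < T < d -> M < vrat alpha T.
Proof.
  intros Ha HM. unfold vrat. assert (Hk := vrat_coef_pos alpha Ha).
  set (k := kv * (alpha ^ 2 / (1 - alpha))) in *. clearbody k.
  exists (Rmin 1 (k / M)). split.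
  { apply Rmin_glb_lt; [lra|]. now apply Rdiv_lt_0_compat. }
  intros T [HT Hlt].
  assert (H1 := Rmin_l 1 (k / M)). assert (H2 := Rmin_r 1 (k / M)).
  apply Rlt_trans with (k * / T).
  - apply Rmult_lt_reg_r with T; [easy|].
    replace (k * / T * T) with (M * (k / M)) by (field; lra).
    apply Rmult_lt_compat_l; lra.
  - apply Rmult_lt_compat_l; [easy|]. apply vrat_exp_gt; lra.
Qed.

Lemma prat_large_T alpha M : 0 < alpha < 1 -> 
  exists N, 0 < N /\ forall T, N < T -> M < prat alpha T.
Proof.
  intros Ha. unfold prat. assert (Hk := prat_coef_pos alpha Ha).
  set (k := kp * ((1 - alpha ^ 2) / alpha ^ 2)) in *. clearbody k.
  exists (Rmax 1 (M / k * exp Ti)).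
  assert (H1 := Rmax_l 1 (M / k * exp Ti)).
  assert (H2 := Rmax_r 1 (M / k * exp Ti)).
  split; [lra|]. intros T HT.
  apply Rlt_trans with (k * (T * exp (- Ti))).
  - rewrite exp_Ropp. assert (He := exp_pos Ti).
    replace M with (k * (M / k * exp Ti * / exp Ti)) by (field; lra).
    apply Rmult_lt_compat_l; [easy|]. apply Rmult_lt_compat_r; [|lra].
    now apply Rinv_0_lt_compat.
  - apply Rmult_lt_compat_l; [easy|]. apply prat_exp_gt; lra.
Qed.

Lemma vrat_large_T alpha eps : 0 < alpha < 1 -> 0 < eps ->
  exists N, 0 < N /\ forall T, N < T -> vrat alpha T < eps.
Proof.
  intros Ha He. unfold vrat. assert (Hk := vrat_coef_pos alpha Ha).
  set (k := kv * (alpha ^ 2 / (1 - alpha))) in *. clearbody k.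
  exists (Rmax 1 (k / eps * exp Ti)).
  assert (H1 := Rmax_l 1 (k / eps * exp Ti)).
  assert (H2 := Rmax_r 1 (k / eps * exp Ti)).
  split; [lra|]. intros T HT.
  apply Rlt_trans with (k * (/ T * exp Ti)).
  - apply Rmult_lt_compat_l; [easy|]. apply vrat_exp_lt; lra.
  - apply Rmult_lt_reg_r with (T / eps).
    { apply Rdiv_lt_0_compat; lra. }
    replace (eps * (T / eps)) with T by (field; lra).
    replace (k * (/ T * exp Ti) * (T / eps)) with (k / eps * exp Ti) by (field; lra).
    lra.
Qed.

Lemma prat_to_0 T eps : 0 < eps -> at_left 1 (fun alpha => prat alpha T < eps).
Proof.
  intros He. apply at_left_lt_of_continuous.
  - apply (@ex_derive_continuous R_AbsRing R_NormedModule). unfold prat.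
    auto_derive. lra.
  - unfold prat. replace ((1 - 1 ^ 2) / 1 ^ 2) with 0 by field. lra.
Qed.

Lemma vrat_to_infty T M : at_left 1 (fun alpha => M < vrat alpha T).
Proof.
  set (E := exp (Ti / T - 3 / 2 * ln T)).
  assert (HE : 0 < E) by apply exp_pos.
  set (h := fun alpha => M * (1 - alpha) - kv * alpha ^ 2 * E).
  assert (Hh : at_left 1 (fun alpha => h alpha < 0)).
  { apply at_left_lt_of_continuous.
    - apply (@ex_derive_continuous R_AbsRing R_NormedModule). unfold h. now auto_derive.
    - unfold h. nra. }
  generalize (filter_and _ _ at_left_unit Hh). apply filter_imp.
  intros alpha [Ha Hlt]. unfold h in Hlt. unfold vrat. fold E.
  apply Rmult_lt_reg_r with (1 - alpha); [lra|].
  replace (kv * (alpha ^ 2 / (1 - alpha)) * E * (1 - alpha))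
    with (kv * alpha ^ 2 * E) by (field; lra). lra.
Qed.

(** * The two level curves *)

Variable m : R.
Hypothesis Hm : 0 < m.

(** Truncating both factors at 0 makes each branch of the level set
    [(prat - 1) (1 - vrat) = m] the full zero set of a continuous function, which
    changes sign once, from negative to positive. *)
Definition excess_plus (alpha T : R) : R :=
  pos_prod (prat alpha T - 1) (1 - vrat alpha T) - m.

Definition excess_minus (alpha T : R) : R :=
  m - pos_prod (vrat alpha T - 1) (1 - prat alpha T).

(** The product of the two factors is positive, so they have the same sign;
    each sign corresponds to one branch. *)
Lemma level_split alpha T :
  (prat alpha T - 1) * (1 - vrat alpha T) = m <->
  excess_minus alpha T = 0 \/ excess_plus alpha T = 0.
Proof.
  unfold excess_plus, excess_minus. split.
  - intros H. destruct (Rle_lt_dec (prat alpha T) 1) as [Hq|Hq].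
    + left. assert (Hq1 : prat alpha T < 1) by (destruct Hq as [|E]; [easy|rewrite E in H; lra]).
      rewrite pos_prod_pos; nra.
    + right. rewrite pos_prod_pos; nra.
  - intros [H|H].
    + destruct (pos_prod_level m (vrat alpha T - 1) (1 - prat alpha T) Hm) as [_ [_ H1]]; lra.
    + destruct (pos_prod_level m (prat alpha T - 1) (1 - vrat alpha T) Hm) as [_ [_ H1]]; lra.
Qed.

Lemma excess_plus_zero alpha T : excess_plus alpha T = 0 ->
  1 < prat alpha T /\ vrat alpha T < 1 /\ (prat alpha T - 1) * (1 - vrat alpha T) = m.
Proof.
  unfold excess_plus. intros H.
  destruct (pos_prod_level m (prat alpha T - 1) (1 - vrat alpha T) Hm) as [H1 [H2 H3]]; lra.
Qed.

Lemma excess_minus_zero alpha T : excess_minus alpha T = 0 ->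
  1 < vrat alpha T /\ prat alpha T < 1 /\ (vrat alpha T - 1) * (1 - prat alpha T) = m.
Proof.
  unfold excess_minus. intros H.
  destruct (pos_prod_level m (vrat alpha T - 1) (1 - prat alpha T) Hm) as [H1 [H2 H3]]; lra.
Qed.

Lemma excess_minus_neg alpha T :
  prat alpha T < / 2 -> 1 + 2 * m < vrat alpha T -> excess_minus alpha T < 0.
Proof.
  intros Hq Hv. unfold excess_minus. rewrite pos_prod_pos; nra.
Qed.

Lemma excess_plus_neg alpha T : prat alpha T <= 1 -> excess_plus alpha T < 0.
Proof.
  intros Hq. unfold excess_plus. rewrite pos_prod_npos_l; lra.
Qed.

Lemma continuous_level_product (x : R) (q v : R -> R) :
  continuous q x -> continuous v x ->
  continuous (fun y => pos_prod (q y - 1) (1 - v y)) x.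
Proof.
  intros Hq Hv. apply continuous_pos_prod.
  - apply (continuous_minus q (fun _ => 1)); [easy|apply continuous_const].
  - apply (continuous_minus (fun _ => 1) v); [apply continuous_const|easy].
Qed.

Lemma excess_plus_crosses alpha : 0 < alpha < 1 ->
  exists t, 0 < t /\ crosses_at (excess_plus alpha) t.
Proof.
  intros Ha.
  destruct (prat_small_T alpha 1 Ha Rlt_0_1) as [d [Hd Hsmall]].
  destruct (prat_large_T alpha (1 + 2 * m) Ha) as [N1 [HN1 Hlarge1]].
  destruct (vrat_large_T alpha (/ 2) Ha ltac:(lra)) as [N2 [HN2 Hlarge2]].
  assert (Ha1 := Hsmall (d / 2) ltac:(lra)).
  assert (Hb1 := Hlarge1 (N1 + N2) ltac:(lra)).
  assert (Hb2 := Hlarge2 (N1 + N2) ltac:(lra)).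
  (* At the upper end the product exceeds [2 m * (1/2)]. *)
  apply crosses_at_exists with (a := d / 2) (b := N1 + N2).
  - intros x Hx. apply (continuous_minus _ (fun _ => m)); [|apply continuous_const].
    apply continuous_level_product; [now apply continuous_prat_T|now apply continuous_vrat_T].
  - lra.
  - apply (prat_lt_inv alpha); lra.
  - apply excess_plus_neg. lra.
  - unfold excess_plus. rewrite pos_prod_pos; nra.
  - intros x y Hxy H0. unfold excess_plus in *.
    assert (H1 := prat_incr alpha x y Ha Hxy). assert (H2 := vrat_decr alpha x y Ha Hxy).
    enough (m < pos_prod (prat alpha y - 1) (1 - vrat alpha y)) by lra.
    apply (pos_prod_level_gt m (prat alpha x - 1) (1 - vrat alpha x)); lra.
  - intros x y Hxy H0. unfold excess_plus in *.
    assert (H1 := prat_incr alpha x y Ha Hxy). assert (H2 := vrat_decr alpha x y Ha Hxy).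
    enough (pos_prod (prat alpha x - 1) (1 - vrat alpha x) < m) by lra.
    apply (pos_prod_level_lt m (prat alpha y - 1) (1 - vrat alpha y)); lra.
Qed.

Lemma excess_minus_crosses alpha : 0 < alpha < 1 ->
  exists t, 0 < t /\ crosses_at (excess_minus alpha) t.
Proof.
  intros Ha.
  destruct (prat_large_T alpha 1 Ha) as [N [HN Hlarge]].
  destruct (prat_small_T alpha (/ 2) Ha ltac:(lra)) as [d1 [Hd1 Hsmall1]].
  destruct (vrat_small_T alpha (1 + 2 * m) Ha ltac:(lra)) as [d2 [Hd2 Hsmall2]].
  set (d := Rmin d1 d2 / 2).
  assert (Hd : 0 < d /\ d < d1 /\ d < d2).
  { unfold d. assert (H1 := Rmin_l d1 d2). assert (H2 := Rmin_r d1 d2).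
    assert (H3 := Rmin_glb_lt d1 d2 0 Hd1 Hd2). lra. }
  assert (Ha1 := Hsmall1 d ltac:(lra)). assert (Ha2 := Hsmall2 d ltac:(lra)).
  assert (Hb1 := Hlarge (N + 1) ltac:(lra)).
  apply crosses_at_exists with (a := d) (b := N + 1).
  - intros x Hx. apply (continuous_minus (fun _ => m)); [apply continuous_const|].
    apply continuous_level_product; [now apply continuous_vrat_T|now apply continuous_prat_T].
  - lra.
  - apply (prat_lt_inv alpha); lra.
  - now apply excess_minus_neg.
  - unfold excess_minus. rewrite pos_prod_npos_r; lra.
  - intros x y Hxy H0. unfold excess_minus in *.
    assert (H1 := prat_incr alpha x y Ha Hxy). assert (H2 := vrat_decr alpha x y Ha Hxy).
    enough (pos_prod (vrat alpha y - 1) (1 - prat alpha y) < m) by lra.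
    apply (pos_prod_level_lt m (vrat alpha x - 1) (1 - prat alpha x)); lra.
  - intros x y Hxy H0. unfold excess_minus in *.
    assert (H1 := prat_incr alpha x y Ha Hxy). assert (H2 := vrat_decr alpha x y Ha Hxy).
    enough (m < pos_prod (vrat alpha x - 1) (1 - prat alpha x)) by lra.
    apply (pos_prod_level_gt m (vrat alpha y - 1) (1 - prat alpha y)); lra.
Qed.

(** * Order, regularity and limits of the two curves *)

Variables Tm Tp : R -> R.
Hypothesis HTm : forall alpha, 0 < alpha < 1 ->
  0 < Tm alpha /\ crosses_at (excess_minus alpha) (Tm alpha).
Hypothesis HTp : forall alpha, 0 < alpha < 1 ->
  0 < Tp alpha /\ crosses_at (excess_plus alpha) (Tp alpha).

Lemma Tm_spec alpha : 0 < alpha < 1 ->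
  1 < vrat alpha (Tm alpha) /\ prat alpha (Tm alpha) < 1 /\
  (vrat alpha (Tm alpha) - 1) * (1 - prat alpha (Tm alpha)) = m.
Proof. intros Ha. now apply excess_minus_zero, (HTm alpha Ha). Qed.

Lemma Tp_spec alpha : 0 < alpha < 1 ->
  1 < prat alpha (Tp alpha) /\ vrat alpha (Tp alpha) < 1 /\
  (prat alpha (Tp alpha) - 1) * (1 - vrat alpha (Tp alpha)) = m.
Proof. intros Ha. now apply excess_plus_zero, (HTp alpha Ha). Qed.

Lemma Tm_lt_of_prat_ge_1 alpha T :
  0 < alpha < 1 -> 0 < T -> 1 <= prat alpha T -> Tm alpha < T.
Proof.
  intros Ha HT Hq. apply (prat_lt_inv alpha); try easy; [now apply HTm|].
  assert (H := Tm_spec alpha Ha). lra.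
Qed.

Lemma lt_Tp_of_prat_le_1 alpha T :
  0 < alpha < 1 -> 0 < T -> prat alpha T <= 1 -> T < Tp alpha.
Proof.
  intros Ha HT Hq. apply (prat_lt_inv alpha); try easy; [now apply HTp|].
  assert (H := Tp_spec alpha Ha). lra.
Qed.

Lemma Tm_lt_Tp alpha : 0 < alpha < 1 -> Tm alpha < Tp alpha.
Proof.
  intros Ha. apply lt_Tp_of_prat_le_1; try easy; [now apply HTm|].
  assert (H := Tm_spec alpha Ha). lra.
Qed.

Lemma locally_unit alpha : 0 < alpha < 1 -> locally alpha (fun y => 0 < y < 1).
Proof.
  intros Ha. apply filter_and; [apply (open_gt 0)|apply (open_lt 1)]; easy.
Qed.

Lemma continuous_Tp alpha : 0 < alpha < 1 -> continuous Tp alpha.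
Proof.
  intros Ha. apply (crossing_continuous excess_plus).
  - intros T HT. apply (continuous_minus _ (fun _ => m)); [|apply continuous_const].
    apply continuous_level_product;
      [now apply continuous_prat_alpha|now apply continuous_vrat_alpha].
  - generalize (locally_unit alpha Ha). apply filter_imp. exact HTp.
Qed.

Lemma continuous_Tm alpha : 0 < alpha < 1 -> continuous Tm alpha.
Proof.
  intros Ha. apply (crossing_continuous excess_minus).
  - intros T HT. apply (continuous_minus (fun _ => m)); [apply continuous_const|].
    apply (continuous_level_product alpha (fun y => vrat y T) (fun y => prat y T));
      [now apply continuous_vrat_alpha|now apply continuous_prat_alpha].
  - generalize (locally_unit alpha Ha). apply filter_imp. exact HTm.
Qed.

(** Along the upper curve both [prat - 1] and [1 - vrat] are positive and
    increase with [T] at positive speed, so the product has a positive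
    derivative in [T]. *)
Lemma ex_derive_Tp alpha : 0 < alpha < 1 -> ex_derive Tp alpha.
Proof.
  intros Ha. destruct (HTp alpha Ha) as [HT _].
  destruct (Tp_spec alpha Ha) as [Hq [Hv _]].
  destruct (ex_derive_prat_coef alpha Ha) as [dA HA].
  destruct (ex_derive_vrat_coef alpha Ha) as [dB HB].
  destruct (is_derive_prat_exp (Tp alpha) HT) as [dq [Hdq Hdq']].
  destruct (is_derive_vrat_exp (Tp alpha) HT) as [dv [Hdv Hdv']].
  assert (Dq := differentiable_pt_lim_sep _ _ _ _ _ _ HA Hdq').
  assert (Dv := differentiable_pt_lim_sep _ _ _ _ _ _ HB Hdv').
  assert (Dprod : differentiable_pt_lim (fun x y => (x - 1) * (1 - y))
            (prat alpha (Tp alpha)) (vrat alpha (Tp alpha))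
            (1 - vrat alpha (Tp alpha)) (- (prat alpha (Tp alpha) - 1))).
  { apply differentiable_pt_lim_bilinear. intros u v.
    rewrite <- Rabs_mult, <- Rabs_Ropp. f_equal. ring. }
  assert (D := differentiable_pt_lim_comp (fun x y => (x - 1) * (1 - y)) prat vrat
                 alpha (Tp alpha) _ _ _ _ _ _ Dprod Dq Dv).
  eexists. eapply is_derive_implicit; [exact D| |now apply continuous_Tp|].
  - assert (HcA := prat_coef_pos alpha Ha). assert (HcB := vrat_coef_pos alpha Ha).
    apply Rgt_not_eq, Rplus_lt_0_compat.
    + apply Rmult_lt_0_compat; [lra|]. now apply Rmult_lt_0_compat.
    + rewrite Ropp_mult_distr_l_reverse, Ropp_mult_distr_r.
      apply Rmult_lt_0_compat; [lra|]. nra.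
  - generalize (locally_unit alpha Ha). apply filter_imp. intros y Hy.
    destruct (Tp_spec y Hy) as [_ [_ ->]]. now destruct (Tp_spec alpha Ha) as [_ [_ ->]].
Qed.

Lemma Tm_to_infty : filterlim Tm (at_left 1) (Rbar_locally p_infty).
Proof.
  apply filterlim_p_infty_intro; [apply _|]. intros M HM.
  generalize (filter_and _ _ at_left_unit (filter_and _ _
    (prat_to_0 M (/ 2) pos_half_prf) (vrat_to_infty M (1 + 2 * m)))).
  apply filter_imp. intros alpha [Ha [Hq Hv]].
  apply crosses_at_neg with (h := excess_minus alpha); [now apply HTm|easy|].
  now apply excess_minus_neg.
Qed.

Lemma Tp_to_infty : filterlim Tp (at_left 1) (Rbar_locally p_infty).
Proof.
  apply filterlim_p_infty_intro; [apply _|]. intros M HM.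
  generalize (filter_and _ _ at_left_unit (prat_to_0 M 1 Rlt_0_1)).
  apply filter_imp. intros alpha [Ha Hq]. apply lt_Tp_of_prat_le_1; lra.
Qed.

(** * Asymptotics near full ionization *)

(** On both curves the larger of the two ratios exceeds their product, which
    is proportional to [(1 + alpha) T] and so tends to infinity; since the
    product of the two distances to 1 is [m], the smaller ratio tends to 1. *)
Lemma smaller_ratio_gt x y eps :
  0 < eps -> 1 < x -> y < 1 -> (x - 1) * (1 - y) = m -> 1 + m / eps < x * y ->
  1 - eps < y < 1.
Proof.
  intros He Hx Hy Heq Hs. split; [|easy].
  assert (Hme : 0 < m / eps) by now apply Rdiv_lt_0_compat.
  assert (H1 : m / eps < x - 1) by nra.
  apply Rnot_le_lt. intros Hle.
  assert (H2 : m / eps * eps < (x - 1) * (1 - y)) by nra.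
  replace (m / eps * eps) with m in H2 by (field; lra). lra.
Qed.

Lemma ratio_product_large (f : R -> R) M :
  filterlim f (at_left 1) (Rbar_locally p_infty) ->
  at_left 1 (fun alpha => M < prat alpha (f alpha) * vrat alpha (f alpha)).
Proof.
  intros Hf. set (c := kp * kv).
  assert (Hc : 0 < c) by now apply Rmult_lt_0_compat.
  assert (H : at_left 1 (fun alpha => Rmax 0 (M / c) < f alpha)).
  { apply Hf. exists (Rmax 0 (M / c)). easy. }
  generalize (filter_and _ _ at_left_unit H). apply filter_imp. intros alpha [Ha Hlt].
  assert (H1 := Rmax_l 0 (M / c)). assert (H2 := Rmax_r 0 (M / c)).
  rewrite prat_mult_vrat by lra. fold c.
  replace M with (c * (M / c)) by (field; lra).
  rewrite Rmult_assoc. apply Rmult_lt_compat_l; nra.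
Qed.

Lemma vrat_along_Tp : filterlim (fun alpha => vrat alpha (Tp alpha)) (at_left 1) (locally 1).
Proof.
  apply filterlim_1_from_below; [apply _|]. intros eps He.
  generalize (filter_and _ _ at_left_unit (ratio_product_large Tp (1 + m / eps) Tp_to_infty)).
  apply filter_imp. intros alpha [Ha Hs]. destruct (Tp_spec alpha Ha) as [H1 [H2 H3]].
  now apply smaller_ratio_gt with (x := prat alpha (Tp alpha)).
Qed.

Lemma prat_along_Tm : filterlim (fun alpha => prat alpha (Tm alpha)) (at_left 1) (locally 1).
Proof.
  apply filterlim_1_from_below; [apply _|]. intros eps He.
  generalize (filter_and _ _ at_left_unit (ratio_product_large Tm (1 + m / eps) Tm_to_infty)).
  apply filter_imp. intros alpha [Ha Hs]. destruct (Tm_spec alpha Ha) as [H1 [H2 H3]].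
  apply smaller_ratio_gt with (x := vrat alpha (Tm alpha)); try easy.
  now rewrite Rmult_comm.
Qed.

Lemma exp_div_to_1 (f : R -> R) s :
  filterlim f (at_left 1) (Rbar_locally p_infty) ->
  filterlim (fun alpha => exp (s * / f alpha)) (at_left 1) (locally 1).
Proof.
  intros Hf.
  assert (Hinv : filterlim (fun alpha => s * / f alpha) (at_left 1) (locally (s * 0))).
  { apply filterlim_Rmult; [apply _|apply filterlim_const|].
    apply (filterlim_comp _ _ _ f Rinv _ _ _ Hf).
    now apply (filterlim_Rbar_inv p_infty). }
  rewrite Rmult_0_r in Hinv.
  assert (Hexp : filterlim exp (locally 0) (locally (exp 0))) by apply continuous_exp.
  rewrite exp_0 in Hexp. exact (filterlim_comp _ _ _ _ _ _ _ _ Hinv Hexp).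
Qed.

(** Solving the formula for [vrat] for [1 - alpha] leaves, besides the stated
    power of [T], only the factors [alpha^2], [exp (Ti / T)] and [1 / vrat],
    all of which tend to 1. *)
Lemma one_minus_alpha_along_Tp :
  is_equiv (at_left 1) (fun alpha => 1 - alpha)
    (fun alpha => kv * exp (- (3 / 2) * ln (Tp alpha))).
Proof.
  apply is_equiv_of_factor with
    (h := fun alpha => alpha ^ 2 * (exp (Ti * / Tp alpha) * / vrat alpha (Tp alpha))).
  { apply _. }
  - generalize at_left_unit. apply filter_imp. intros alpha Ha.
    unfold vrat. set (T := Tp alpha).
    replace (Ti / T - 3 / 2 * ln T) with (Ti * / T + - (3 / 2) * ln T)
      by (unfold Rdiv; ring).
    rewrite exp_plus.
    assert (H1 := exp_pos (Ti * / T)). assert (H2 := exp_pos (- (3 / 2) * ln T)).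
    field. lra.
  - apply filterlim_Rmult_1; [apply _| |apply filterlim_Rmult_1; [apply _| |]].
    + apply filterlim_at_left_continuous; [|ring].
      apply (@ex_derive_continuous R_AbsRing R_NormedModule). now auto_derive.
    + apply exp_div_to_1, Tp_to_infty.
    + assert (Hinv : filterlim Rinv (locally 1) (locally (/ 1))).
      { apply (@ex_derive_continuous R_AbsRing R_NormedModule Rinv).
        auto_derive. lra. }
      rewrite Rinv_1 in Hinv. exact (filterlim_comp _ _ _ _ _ _ _ _ vrat_along_Tp Hinv).
Qed.

Lemma one_minus_alpha_along_Tm :
  is_equiv (at_left 1) (fun alpha => 1 - alpha)
    (fun alpha => / (2 * kp) * exp (- (5 / 2) * ln (Tm alpha))).
Proof.
  apply is_equiv_of_factor with
    (h := fun alpha => 2 * alpha ^ 2 / (1 + alpha) *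
                       (exp (Ti * / Tm alpha) * prat alpha (Tm alpha))).
  { apply _. }
  - generalize at_left_unit. apply filter_imp. intros alpha Ha.
    unfold prat. set (T := Tm alpha).
    replace (5 / 2 * ln T - Ti / T) with (- (Ti * / T) + - (- (5 / 2) * ln T))
      by (unfold Rdiv; ring).
    rewrite exp_plus, !exp_Ropp.
    assert (H1 := exp_pos (Ti * / T)). assert (H2 := exp_pos (- (5 / 2) * ln T)).
    field. lra.
  - apply filterlim_Rmult_1; [apply _| |apply filterlim_Rmult_1; [apply _| |]].
    + apply filterlim_at_left_continuous; [|field].
      apply (@ex_derive_continuous R_AbsRing R_NormedModule). auto_derive. lra.
    + apply exp_div_to_1, Tm_to_infty.
    + apply prat_along_Tm.
Qed.

(** * Comparison with the Hugoniot locus *)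

(** Where [vrat >= 4], the term [4 prat vrat] dominates [prat] and [vrat]
    compensates the constant [-4].  Where [vrat < 4], the temperature is large
    because [vrat] blows up at fixed temperature; hence so is [prat vrat], and
    below the upper curve [vrat > 1/2], which gives [prat < 2 prat vrat]. *)
Lemma hugoniot_pos_below_Tp alpha0 c :
  alpha0 < 1 -> 0 < c ->
  at_left 1 (fun alpha => forall T, 0 < T -> T <= Tp alpha ->
    0 < 4 * (prat alpha T * vrat alpha T - 1) + c * (alpha - alpha0)
        - prat alpha T + vrat alpha T).
Proof.
  intros H0 Hc.
  set (k := kp * kv). assert (Hk : 0 < k) by now apply Rmult_lt_0_compat.
  assert (Hv : at_left 1 (fun alpha => / 2 < vrat alpha (Tp alpha))).
  { apply (vrat_along_Tp (fun z => / 2 < z)). apply (open_gt (/ 2)). lra. }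
  assert (Ha0 : at_left 1 (fun alpha => - alpha < - alpha0)).
  { apply at_left_lt_of_continuous; [|lra].
    apply (@ex_derive_continuous R_AbsRing R_NormedModule). now auto_derive. }
  generalize (filter_and _ _ (filter_and _ _ at_left_unit Ha0)
               (filter_and _ _ Hv (vrat_to_infty (2 / k) 4))).
  apply filter_imp. intros alpha [[Ha Hlt] [Hv1 Hv2]] T HT HTle.
  assert (Hca : 0 < c * (alpha - alpha0)) by (apply Rmult_lt_0_compat; lra).
  assert (Hq := prat_pos alpha T Ha).
  destruct (Rle_lt_dec 4 (vrat alpha T)) as [H4|H4]; [nra|].
  assert (HT2 : 2 / k < T).
  { apply Rnot_le_lt. intros [Hle|Hle]; [|rewrite Hle in H4; lra].
    assert (H := vrat_decr alpha T (2 / k) Ha (conj HT Hle)). lra. }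
  assert (Hs : 2 < prat alpha T * vrat alpha T).
  { rewrite prat_mult_vrat by easy. fold k.
    replace 2 with (k * (2 / k)) by (field; lra).
    rewrite Rmult_assoc. apply Rmult_lt_compat_l; nra. }
  assert (Hvh : / 2 < vrat alpha T).
  { destruct HTle as [Hl| ->]; [|easy].
    assert (H := vrat_decr alpha T (Tp alpha) Ha (conj HT Hl)). lra. }
  nra.
Qed.

End IonizedGas.

(** * Normalization by the reference state *)

Section Reference.

Variables a Ti kappa alpha0 T0 : R.
Hypotheses (Ha2 : 0 < a ^ 2) (HTi : 0 < Ti) (Hkappa : 0 < kappa)
  (Ha0 : 0 < alpha0 < 1) (HT0 : 0 < T0).

Definition prat_const : R :=
  alpha0 ^ 2 / (1 - alpha0 ^ 2) * / exp (5 / 2 * ln T0 - Ti / T0).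

Definition vrat_const : R :=
  (1 - alpha0) / alpha0 ^ 2 * / exp (Ti / T0 - 3 / 2 * ln T0).

Lemma prat_const_pos : 0 < prat_const.
Proof.
  apply Rmult_lt_0_compat; [apply Rdiv_lt_0_compat; nra|].
  apply Rinv_0_lt_compat, exp_pos.
Qed.

Lemma vrat_const_pos : 0 < vrat_const.
Proof.
  apply Rmult_lt_0_compat; [apply Rdiv_lt_0_compat; nra|].
  apply Rinv_0_lt_compat, exp_pos.
Qed.

Lemma pressure_exp alpha T :
  pressure Ti kappa alpha T =
  / kappa * ((1 - alpha ^ 2) / alpha ^ 2) * exp (5 / 2 * ln T - Ti / T).
Proof.
  unfold pressure, Rpower, Rminus. rewrite exp_plus. ring.
Qed.

Lemma pressure_pos alpha T : 0 < alpha < 1 -> 0 < pressure Ti kappa alpha T.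
Proof.
  intros Ha. rewrite pressure_exp.
  apply Rmult_lt_0_compat; [|apply exp_pos].
  apply Rmult_lt_0_compat; [now apply Rinv_0_lt_compat|].
  apply Rdiv_lt_0_compat; nra.
Qed.

Lemma spec_volume_pos alpha T :
  0 < alpha < 1 -> 0 < T -> 0 < spec_volume a Ti kappa alpha T.
Proof.
  intros Ha HT. apply Rdiv_lt_0_compat; [|now apply pressure_pos].
  apply Rmult_lt_0_compat; [|easy]. apply Rmult_lt_0_compat; lra.
Qed.

Lemma spec_volume_exp alpha T : 0 < alpha < 1 -> 0 < T ->
  spec_volume a Ti kappa alpha T =
  a ^ 2 * kappa * (alpha ^ 2 / (1 - alpha)) * exp (Ti / T - 3 / 2 * ln T).
Proof.
  intros Ha HT. unfold spec_volume. rewrite pressure_exp.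
  replace (Ti / T - 3 / 2 * ln T) with (ln T + - (5 / 2 * ln T - Ti / T)) by (field; lra).
  rewrite exp_plus, exp_Ropp, exp_ln by easy.
  assert (H := exp_pos (5 / 2 * ln T - Ti / T)).
  field. repeat split; try lra. nra.
Qed.

Lemma pressure_ratio alpha T : 0 < alpha < 1 ->
  pressure Ti kappa alpha T / pressure Ti kappa alpha0 T0 = prat Ti prat_const alpha T.
Proof.
  intros Ha. rewrite !pressure_exp. unfold prat, prat_const.
  assert (H := exp_pos (5 / 2 * ln T0 - Ti / T0)).
  field. repeat split; try lra. nra.
Qed.

Lemma spec_volume_ratio alpha T : 0 < alpha < 1 -> 0 < T ->
  spec_volume a Ti kappa alpha T / spec_volume a Ti kappa alpha0 T0
  = vrat Ti vrat_const alpha T.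
Proof.
  intros Halpha HT. rewrite !spec_volume_exp by easy. unfold vrat, vrat_const.
  assert (H := exp_pos (Ti / T0 - 3 / 2 * ln T0)).
  assert (Ha : a <> 0) by (intros Hz; rewrite Hz in Ha2; lra).
  field. repeat split; try easy; lra.
Qed.

Lemma prat_reference : prat Ti prat_const alpha0 T0 = 1.
Proof.
  rewrite <- pressure_ratio by easy. apply Rinv_r, Rgt_not_eq. now apply pressure_pos.
Qed.

(** With [p0 v0 = a^2 (1 + alpha0) T0] and [p v / (p0 v0)] equal to the product
    of the two ratios, every term of the Hugoniot function is a function of
    these ratios except the ionization energy. *)
Lemma hugoniot_normalized alpha T : 0 < alpha < 1 -> 0 < T ->
  thermo_hugoniot a Ti kappa alpha0 T0 alpha T <->
  4 * (prat Ti prat_const alpha T * vrat Ti vrat_const alpha T - 1)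
    + 2 * Ti / ((1 + alpha0) * T0) * (alpha - alpha0)
    - prat Ti prat_const alpha T + vrat Ti vrat_const alpha T = 0.
Proof.
  intros Ha HT. unfold thermo_hugoniot, energy.
  assert (Hp0 := pressure_pos alpha0 T0 Ha0).
  assert (Hv0 := spec_volume_pos alpha0 T0 Ha0 HT0).
  assert (Hpv0 : pressure Ti kappa alpha0 T0 * spec_volume a Ti kappa alpha0 T0
                 = a ^ 2 * (1 + alpha0) * T0) by (unfold spec_volume; field; lra).
  assert (Hp := pressure_pos alpha T Ha).
  assert (Hpv : pressure Ti kappa alpha T * spec_volume a Ti kappa alpha T
                 = a ^ 2 * (1 + alpha) * T) by (unfold spec_volume; field; lra).
  rewrite <- pressure_ratio, <- spec_volume_ratio by easy.
  set (p := pressure Ti kappa alpha T) in *.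
  set (v := spec_volume a Ti kappa alpha T) in *.
  set (p0 := pressure Ti kappa alpha0 T0) in *.
  set (v0 := spec_volume a Ti kappa alpha0 T0) in *.
  set (H := 4 * (p / p0 * (v / v0) - 1) + 2 * Ti / ((1 + alpha0) * T0) * (alpha - alpha0)
            - p / p0 + v / v0).
  assert (HK : 0 < p0 * v0) by now apply Rmult_lt_0_compat.
  assert (E : a ^ 2 * (3 / 2 * (1 + alpha) * T + Ti * alpha) -
      a ^ 2 * (3 / 2 * (1 + alpha0) * T0 + Ti * alpha0) +
      / 2 * (p + p0) * (v - v0) = p0 * v0 / 2 * H).
  { replace (a ^ 2 * (3 / 2 * (1 + alpha) * T + Ti * alpha) -
      a ^ 2 * (3 / 2 * (1 + alpha0) * T0 + Ti * alpha0))
      with (3 / 2 * (p * v) - 3 / 2 * (p0 * v0) + a ^ 2 * Ti * (alpha - alpha0))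
      by (rewrite Hpv, Hpv0; ring).
    replace (a ^ 2 * Ti * (alpha - alpha0))
      with (p0 * v0 * (Ti / ((1 + alpha0) * T0) * (alpha - alpha0)))
      by (rewrite Hpv0; field; lra).
    unfold H. field. repeat split; lra. }
  rewrite E. split; intros H0.
  - apply Rmult_integral in H0. destruct H0; lra.
  - rewrite H0. ring.
Qed.

End Reference.

(** * The curves G = 0 *)

Theorem proposition5p5 :
  forall (a Ti kappa : R), 0 < a ^ 2 -> 0 < Ti -> 0 < kappa ->
  forall (alpha0 u0 T0 : R), 0 < alpha0 < 1 -> 0 < T0 ->
  forall u : R, u <> u0 ->
  exists Tm Tp : R -> R,
    is_union_of_graphs
      (fun alpha T => G a Ti kappa alpha0 u0 T0 alpha u T = 0) Tm Tp /\
    (forall alpha, 0 < alpha < 1 -> continuous Tm alpha) /\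
    (forall alpha, 0 < alpha < 1 -> continuous Tp alpha) /\
    (forall alpha, 0 < alpha < 1 -> Tm alpha < Tp alpha) /\
    Tm alpha0 < T0 < Tp alpha0 /\
    (forall alpha, 0 < alpha < 1 -> ex_derive Tp alpha) /\
    (forall alpha, 0 < alpha < 1 ->
       pressure Ti kappa alpha (Tp alpha) > pressure Ti kappa alpha0 T0) /\
    filterlim Tm (at_left 1) (Rbar_locally p_infty) /\
    filterlim Tp (at_left 1) (Rbar_locally p_infty) /\
    is_equiv (at_left 1)
      (fun alpha => 1 - alpha)
      (fun alpha => (1 - alpha0) / alpha0 ^ 2 * exp (- (Ti / T0)) *
                    Rpower (Tp alpha / T0) (- (3 / 2))) /\
    is_equiv (at_left 1)
      (fun alpha => 1 - alpha)
      (fun alpha => (1 - alpha0 ^ 2) / (2 * alpha0 ^ 2) * exp (- (Ti / T0)) *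
                    Rpower (Tm alpha / T0) (- (5 / 2))) /\
    (forall TH : R -> R,
       is_graph (thermo_hugoniot a Ti kappa alpha0 T0) TH ->
       at_left 1 (fun alpha => Tm alpha < TH alpha /\ Tp alpha < TH alpha)).
Proof.
  intros a Ti kappa Ha2 HTi Hkappa alpha0 u0 T0 Ha0 HT0 u Hu.
  set (kp := prat_const Ti alpha0 T0). set (kv := vrat_const Ti alpha0 T0).
  assert (Hkp : 0 < kp) by now apply prat_const_pos.
  assert (Hkv : 0 < kv) by now apply vrat_const_pos.
  set (m := (u - u0) ^ 2 / (a ^ 2 * T0 * (1 + alpha0))).
  assert (Hm : 0 < m).
  { apply Rdiv_lt_0_compat; [apply pow2_gt_0; lra|].
    apply Rmult_lt_0_compat; [now apply Rmult_lt_0_compat|lra]. }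
  destruct (functional_choice (fun alpha t => 0 < alpha < 1 ->
              0 < t /\ crosses_at (excess_minus Ti kp kv m alpha) t)) as [Tm HTm].
  { intros alpha. destruct (Rlt_dec 0 alpha) as [H1|H1]; [|exists 0; lra].
    destruct (Rlt_dec alpha 1) as [H2|H2]; [|exists 0; lra].
    destruct (excess_minus_crosses Ti kp kv HTi Hkp Hkv m Hm alpha (conj H1 H2)) as [t Ht].
    now exists t. }
  destruct (functional_choice (fun alpha t => 0 < alpha < 1 ->
              0 < t /\ crosses_at (excess_plus Ti kp kv m alpha) t)) as [Tp HTp].
  { intros alpha. destruct (Rlt_dec 0 alpha) as [H1|H1]; [|exists 0; lra].
    destruct (Rlt_dec alpha 1) as [H2|H2]; [|exists 0; lra].
    destruct (excess_plus_crosses Ti kp kv HTi Hkp Hkv m Hm alpha (conj H1 H2)) as [t Ht].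
    now exists t. }
  assert (Hlt := Tm_lt_Tp Ti kp kv HTi Hkp m Hm Tm Tp HTm HTp).
  assert (Href : prat Ti kp alpha0 T0 = 1) by now apply (prat_reference Ti kappa).
  exists Tm, Tp. repeat split.
  - now apply HTm.
  - now apply HTp.
  - intros HG. destruct (proj1 (level_split Ti kp kv m Hm alpha T)) as [HF|HF].
    + unfold G in HG. rewrite pressure_ratio, spec_volume_ratio in HG by easy.
      fold kp kv m in HG. lra.
    + left. now apply crosses_at_unique with (1 := proj2 (HTm alpha H)).
    + right. now apply crosses_at_unique with (1 := proj2 (HTp alpha H)).
  - intros HTT. unfold G. rewrite pressure_ratio, spec_volume_ratio by easy.
    fold kp kv m.
    enough ((prat Ti kp alpha T - 1) * (1 - vrat Ti kv alpha T) = m) by lra.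
    apply level_split; [easy|].
    destruct HTT as [->| ->]; [left; apply (HTm alpha H)|right; apply (HTp alpha H)].
  - exact (continuous_Tm Ti kp kv m Tm HTm).
  - exact (continuous_Tp Ti kp kv m Tp HTp).
  - exact Hlt.
  - apply (Tm_lt_of_prat_ge_1 Ti kp kv HTi Hkp m Hm Tm HTm); lra.
  - apply (lt_Tp_of_prat_le_1 Ti kp kv HTi Hkp m Hm Tp HTp); lra.
  - exact (ex_derive_Tp Ti kp kv HTi Hkp Hkv m Hm Tp HTp).
  - intros alpha Ha.
    destruct (Tp_spec Ti kp kv m Hm Tp HTp alpha Ha) as [Hq _].
    unfold kp in Hq. rewrite <- (pressure_ratio Ti kappa) in Hq by easy.
    assert (Hp0 := pressure_pos Ti kappa Hkappa alpha0 T0 Ha0).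
    apply Rmult_lt_compat_r with (r := pressure Ti kappa alpha0 T0) in Hq; [|easy].
    unfold Rdiv in Hq. rewrite Rmult_assoc, Rinv_l in Hq; lra.
  - exact (Tm_to_infty Ti kp kv Hkv m Hm Tm HTm).
  - exact (Tp_to_infty Ti kp kv HTi Hkp m Hm Tp HTp).
  - eapply equiv_trans; [exact (one_minus_alpha_along_Tp Ti kp kv HTi Hkp Hkv m Hm Tp HTp)|].
    apply equiv_ext_loc.
    generalize at_left_unit. apply filter_imp. intros alpha Ha.
    destruct (HTp alpha Ha) as [HT _].
    unfold kv, vrat_const, Rpower. rewrite ln_div by easy.
    rewrite <- exp_Ropp.
    replace (- (Ti / T0 - 3 / 2 * ln T0)) with (- (Ti / T0) + 3 / 2 * ln T0) by ring.
    replace (- (3 / 2) * (ln (Tp alpha) - ln T0))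
      with (3 / 2 * ln T0 + - (3 / 2) * ln (Tp alpha)) by ring.
    rewrite !exp_plus.
    (* The equality lives in the carrier of a normed module; it is cast to [R]. *)
    match goal with |- ?x = ?y => change (@eq R x y) end. ring.
  - eapply equiv_trans; [exact (one_minus_alpha_along_Tm Ti kp kv Hkp Hkv m Hm Tm HTm)|].
    apply equiv_ext_loc.
    generalize at_left_unit. apply filter_imp. intros alpha Ha.
    destruct (HTm alpha Ha) as [HT _].
    unfold kp, prat_const, Rpower. rewrite ln_div by easy.
    rewrite <- exp_Ropp.
    replace (- (5 / 2) * (ln (Tm alpha) - ln T0))
      with (5 / 2 * ln T0 + - (5 / 2) * ln (Tm alpha)) by ring.
    replace (- (5 / 2 * ln T0 - Ti / T0)) with (- (- (Ti / T0) + 5 / 2 * ln T0)) by ring.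
    rewrite exp_Ropp, !exp_plus.
    assert (H1 := exp_pos (- (Ti / T0))). assert (H2 := exp_pos (5 / 2 * ln T0)).
    (* The equality lives in the carrier of a normed module; it is cast to [R]. *)
    match goal with |- ?x = ?y => change (@eq R x y) end.
    field. repeat split; try lra. nra.
  - intros TH [HTHpos HTH].
    assert (Hc : 0 < 2 * Ti / ((1 + alpha0) * T0)).
    { apply Rdiv_lt_0_compat; [lra|]. apply Rmult_lt_0_compat; lra. }
    generalize (filter_and _ _ at_left_unit
      (hugoniot_pos_below_Tp Ti kp kv HTi Hkp Hkv m Hm Tp HTp alpha0 _ (proj2 Ha0) Hc)).
    apply filter_imp. intros alpha [Ha Hpos].
    assert (HT := HTHpos alpha Ha).
    assert (HE := proj2 (HTH alpha (TH alpha) Ha HT) eq_refl).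
    apply hugoniot_normalized in HE; try easy. fold kp kv in HE.
    assert (Hlt1 := Hlt alpha Ha).
    enough (Tp alpha < TH alpha) by lra.
    apply Rnot_le_lt. intros Hle. specialize (Hpos (TH alpha) HT Hle). lra.
Qed.
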